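(* Let $\Xi\subset\mathbb{R}^m$ be compact. Let $U:\mathbb{R}^m\times\Xi\to\mathbb{R}$ be given, for $\theta=(w,b_0)\in\mathbb{R}^{m-1}\times\mathbb{R}$ and $x=(z,y)\in\Xi$ with $z\in\mathbb{R}^{m-1}$, $y\in\mathbb{R}$, by $$U(\theta,x)=|y-\mathfrak{N}(\theta,z)|^2,\qquad \mathfrak{N}(\theta,z)=\frac{1}{1+e^{-(\langle w,z\rangle+b_0)}}.$$ Then: (i) for every $x\in\Xi$ the map $\theta\mapsto U(\theta,x)$ is continuously differentiable, there is a constant $L_\nabla>0$ such that $|\nabla_\theta U(\theta_1,x)-\nabla_\theta U(\theta_2,x)|\le L_\nabla|\theta_1-\theta_2|$ for all $\theta_1,\theta_2\in\mathbb{R}^m$, $x\in\Xi$, and there is a constant $K_\nabla>1$ such that $|\nabla_\theta U(\theta,x)|\le K_\nabla$ for all $\theta\in\mathbb{R}^m$, $x\in\Xi$; (ii) there is a constant $J_U>0$ such that $|U(\theta,x_1)-U(\theta,x_2)|\le J_U(1+|\theta|)|x_1-x_2|$ for all $\theta\in\mathbb{R}^m$ and $x_1,x_2\in\Xi$.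
   Context: $|\cdot|$ denotes the Euclidean norm and $\langle\cdot,\cdot\rangle$ the Euclidean scalar product. *)

(* Defs.v *)
From HB Require Import structures.
From mathcomp Require Import all_boot all_order all_algebra.
From mathcomp Require Import all_classical all_reals all_analysis.

Set Implicit Arguments.
Unset Strict Implicit.
Unset Printing Implicit Defensive.

Import Order.TTheory GRing.Theory Num.Theory.
Import numFieldNormedType.Exports.

Local Open Scope ring_scope.
Local Open Scope classical_set_scope.

(* The canonical norm `|v| on 'rV[R]_m is the sup norm; it induces the same
   topology as the Euclidean norm, so compact, continuous and differentiable
   may be used as they are, but norms of vectors must be written with enorm. *)
Definition dot (R : realType) (m : nat) (u v : 'rV[R]_m) : R :=
  \sum_(i < m) u 0 i * v 0 i.

Definition enorm (R : realType) (m : nat) (u : 'rV[R]_m) : R :=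
  Num.sqrt (dot u u).

Definition gradient (R : realType) (m : nat) (f : 'rV[R]_m -> R)
    (t : 'rV[R]_m) : 'rV[R]_m :=
  \row_(i < m) 'D_(delta_mx 0 i) f t.

(* derive is total, hence the differentiability requirement. *)
Definition continuously_differentiable (R : realType) (m : nat)
    (f : 'rV[R]_m -> R) : Prop :=
  (forall t, differentiable f t) /\ continuous (gradient f).

Lemma diff_gradient (R : realType) (m : nat) (f : 'rV[R]_m -> R)
    (t h : 'rV[R]_m) :
  differentiable f t -> 'd f t h = dot (gradient f t) h.
Proof.
move=> df; rewrite {1}[h]row_sum_delta linear_sum; apply: eq_bigr => i _.
by rewrite linearZ mxE deriveE// mulrC.
Qed.

(* A vector of R^(n+1) is split as (first n coordinates, last coordinate):
   t = (w, b0) for the parameter and x = (z, y) for the data point. *)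
Definition neuron (R : realType) (n : nat) (t : 'rV[R]_(n + 1))
    (z : 'rV[R]_n) : R :=
  1 / (1 + expR (- (dot (lsubmx t) z + rsubmx t 0 0))).

Definition loss (R : realType) (n : nat) (t x : 'rV[R]_(n + 1)) : R :=
  `|rsubmx x 0 0 - neuron t (lsubmx x)| ^+ 2.

(* Main.v *)
(* With a = (z, 1) the neuron is sigmoid <theta, a>, so the loss is the ridge
   function theta |-> (y - sigmoid <theta, a>)^2, whose gradient is a scalar
   function of <theta, a> times the fixed vector a.  That scalar is a cubic
   polynomial in sigmoid <theta, a>, hence bounded and Lipschitz because the
   sigmoid is 1-Lipschitz with values in [0, 1]; Cauchy-Schwarz and the
   boundedness of Xi give all the constants. *)
Require Import Defs.
From HB Require Import structures.
From mathcomp Require Import all_boot all_order all_algebra.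
From mathcomp Require Import all_classical all_reals all_analysis.
From mathcomp Require Import ring lra.

Set Implicit Arguments.
Unset Strict Implicit.
Unset Printing Implicit Defensive.

Import Order.TTheory GRing.Theory Num.Theory.
Import numFieldNormedType.Exports.

Local Open Scope ring_scope.
Local Open Scope classical_set_scope.

(** * Euclidean geometry and calculus of ridge functions *)

Section euclidean_space.
Variables (R : realType) (m : nat).
Implicit Types (u v w : 'rV[R]_m).

Lemma dot_mulmx u v : dot u v = (u *m v^T) 0 0.
Proof. by rewrite mxE; apply: eq_bigr => i _; rewrite mxE. Qed.

Lemma dotC u v : dot u v = dot v u.
Proof. by apply: eq_bigr => i _; rewrite mulrC. Qed.

Lemma dot_linear v : linear (fun u => dot u v : R^o).
Proof.
by move=> k u w; rewrite !dot_mulmx mulmxDl -scalemxAl [LHS]mxE [X in X + _]mxE.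
Qed.

Lemma dotZl k u v : dot (k *: u) v = k * dot u v.
Proof. by rewrite !dot_mulmx -scalemxAl mxE. Qed.

Lemma dotBl u w v : dot (u - w) v = dot u v - dot w v.
Proof. by rewrite !dot_mulmx mulmxBl [LHS]mxE [X in _ + X]mxE. Qed.

Lemma dotBr u v w : dot u (v - w) = dot u v - dot u w.
Proof. by rewrite dotC dotBl ![dot _ u]dotC. Qed.

Lemma dot_ge0 u : 0 <= dot u u.
Proof. by apply: sumr_ge0 => i _; rewrite -expr2 sqr_ge0. Qed.

Lemma dot_eq0 u : dot u u = 0 -> u = 0.
Proof.
move=> /eqP; rewrite psumr_eq0 => [/allP u0|i _]; last by rewrite -expr2 sqr_ge0.
apply/rowP => i; rewrite mxE; apply/eqP.
by have := u0 i (mem_index_enum i); rewrite -expr2 sqrf_eq0.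
Qed.

Lemma enorm_ge0 u : 0 <= enorm u.
Proof. exact: sqrtr_ge0. Qed.

Lemma sqr_enorm u : enorm u ^+ 2 = dot u u.
Proof. by rewrite sqr_sqrtr ?dot_ge0. Qed.

Lemma enormZ k u : enorm (k *: u) = `|k| * enorm u.
Proof.
rewrite /enorm dotZl dotC dotZl mulrA -expr2 sqrtrM ?sqr_ge0//.
by rewrite sqrtr_sqr.
Qed.

(** Cauchy-Schwarz, proved on squares: the vector [|v|^2 u - <u,v> v] has squared norm
    [|v|^2 (|u|^2 |v|^2 - <u,v>^2)], which is nonnegative. The case [v = 0] is split off because the
    factor [|v|^2] gets cancelled. *)
Lemma normr_dot_le u v : `|dot u v| <= enorm u * enorm v.
Proof.
rewrite -(@ler_pXn2r _ 2) ?nnegrE ?mulr_ge0 ?enorm_ge0//.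
rewrite real_normK ?num_real// exprMn !sqr_enorm.
have [/dot_eq0 ->|v0] := eqVneq (dot v v) 0.
  by rewrite dotC -[0 : 'rV_m](scale0r 0) !dotZl !mul0r expr0n mulr0.
have vpos : 0 < dot v v by rewrite lt_def v0 dot_ge0.
have := dot_ge0 (dot v v *: u - dot u v *: v).
rewrite dotBl !dotBr !dotZl ![dot _ (_ *: _)]dotC !dotZl [dot v u]dotC.
rewrite (_ : _ - _ = dot v v * (dot u u * dot v v - dot u v ^+ 2)); last ring.
by rewrite pmulr_rge0// subr_ge0.
Qed.

Lemma differentiable_dot v t : differentiable (fun u => dot u v : R^o) t.
Proof.
rewrite (_ : (fun _ => _) =
    \sum_(i < m) (fun u : 'rV[R]_m => v 0 i *: (u 0 i : R^o))).
  apply: differentiable_sum => i.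
  by apply: differentiableZ; exact: differentiable_coord.
by apply/funext => u; rewrite fct_sumE; apply: eq_bigr => i _; rewrite mulrC.
Qed.

Lemma diff_dot v t :
  'd (fun u => dot u v : R^o) t = (fun u => dot u v) :> (_ -> _).
Proof.
(* Bundling the map as a linear one lets [diff_lin] apply: a continuous linear map is its own
   differential. *)
pose dM := GRing.isLinear.Build _ _ _ _ _ (dot_linear v).
pose d : {linear 'rV[R]_m -> R^o} := HB.pack (fun u => dot u v : R^o) dM.
apply: (@diff_lin _ _ _ d) => u.
exact/differentiable_continuous/differentiable_dot.
Qed.

Lemma differentiable_ridge (h : R -> R) v t : derivable h (dot t v) 1 ->
  differentiable (fun u => h (dot u v)) t.
Proof.
move=> /derivable1_diffP dh.
by apply: (@differentiable_comp _ _ _ _ (fun u => dot u v : R^o) h) => //;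
  exact: differentiable_dot.
Qed.

(** Chain rule: along the [i]-th basis vector the inner map has derivative [v 0 i], so every partial
    derivative is [dh * v 0 i]. *)
Lemma gradient_ridge (h : R -> R) v t (dh : R) : is_derive (dot t v) 1 h dh ->
  gradient (fun u => h (dot u v)) t = dh *: v.
Proof.
move=> Dh; have dhP : derivable h (dot t v) 1 by [].
have /derivable1_diffP dh' := dhP.
apply/rowP => i; rewrite !mxE deriveE; last exact: differentiable_ridge.
rewrite (@diff_comp _ _ _ _ (fun u => dot u v : R^o) h)//; last first.
  exact: differentiable_dot.
rewrite /= diff1E// diff_dot derive1E derive_val.
by rewrite dot_mulmx -rowE !mxE mulrC.
Qed.

(** Passes from the sup norm, in which compactness yields a bound [N], to the Euclidean norm: [m]
    coordinates of size at most [N] give the square root of [m N^2]. *)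
Lemma compact_enorm_bounded (A : set 'rV[R]_m) : compact A ->
  exists2 B : R, 0 <= B & forall u, A u -> enorm u <= B.
Proof.
move=> /compact_bounded[M [_ MA]].
(* [MA] applies only to numbers strictly above [M]; this one is also nonnegative, as squaring
   requires. *)
pose N := `|M| + 1.
exists (Num.sqrt (\sum_(i < m) N ^+ 2)) => [|u Au]; first exact: sqrtr_ge0.
have uN : `|u| <= N.
  by apply: MA Au; rewrite /N (le_lt_trans (ler_norm _))// ltrDl.
apply: ler_wsqrtr; apply: ler_sum => i _; rewrite -expr2 -real_normK ?num_real//.
rewrite ler_pXn2r ?nnegrE ?normr_ge0// ?addr_ge0//; apply: le_trans uN.
rewrite [leRHS]mx_normrE.
by apply: (le_bigmax_cond _ (fun ij => `|u ij.1 ij.2|) (j := (0, i))).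
Qed.

End euclidean_space.

(** * Splitting off the last coordinate *)

Lemma dot_row_mx (R : realType) (m n : nat) (u v : 'rV[R]_m) (w z : 'rV[R]_n) :
  dot (row_mx u w) (row_mx v z) = dot u v + dot w z.
Proof. by rewrite !dot_mulmx tr_row_mx mul_row_col mxE. Qed.

Lemma dot_rV1 (R : realType) (u v : 'rV[R]_1) : dot u v = u 0 0 * v 0 0.
Proof. by rewrite /dot big_ord1. Qed.

Section last_coordinate.
Variables (R : realType) (n : nat).
Implicit Type u : 'rV[R]_(n + 1).

Lemma dot_split u : dot u u = dot (lsubmx u) (lsubmx u) + rsubmx u 0 0 ^+ 2.
Proof. by rewrite -{1 2}[u]hsubmxK dot_row_mx dot_rV1. Qed.

Lemma enorm_lsubmx u : enorm (lsubmx u) <= enorm u.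
Proof. by apply: ler_wsqrtr; rewrite dot_split lerDl sqr_ge0. Qed.

Lemma normr_rsubmx u : `|rsubmx u 0 0| <= enorm u.
Proof.
by rewrite -sqrtr_sqr; apply: ler_wsqrtr; rewrite dot_split lerDr dot_ge0.
Qed.

End last_coordinate.

(** * The sigmoid and the scalar profile of the loss *)

Section sigmoid.
Variable R : realType.
Implicit Types s t y : R.

Definition sigmoid s : R := (1 + expR (- s))^-1.

Let den_gt0 s : 0 < 1 + expR (- s).
Proof. by rewrite addr_gt0 ?expR_gt0. Qed.

Lemma sigmoid_ge0 s : 0 <= sigmoid s.
Proof. by rewrite invr_ge0 ltW. Qed.

Lemma sigmoid_le1 s : sigmoid s <= 1.
Proof. by rewrite invf_le1// lerDl expR_ge0. Qed.

(* For [t <= s], the denominators differ by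
   [e^-t (1 - e^(t-s)) <= e^-t (s - t)], and [e^-t] is below their product. *)
Lemma sigmoid_lipschitz s t : `|sigmoid s - sigmoid t| <= `|s - t|.
Proof.
wlog ts : s t / t <= s.
  move=> H; case: (leP t s) => [/H//|/ltW /H].
  by rewrite distrC [leRHS]distrC.
have es : expR (- s) = expR (- t) * expR (t - s) by rewrite -expRD; congr expR; ring.
have e1 := expR_ge1Dx (t - s).
have dt := expR_gt0 (- t); have ds := expR_gt0 (- s).
have -> : sigmoid s - sigmoid t =
    (expR (- t) - expR (- s)) / ((1 + expR (- s)) * (1 + expR (- t))).
  by rewrite /sigmoid; field; rewrite !gt_eqF.
rewrite ger0_norm; last first.
  by rewrite divr_ge0 ?subr_ge0 ?ler_expR ?lerN2// ltW ?mulr_gt0.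
rewrite ger0_norm ?subr_ge0// ler_pdivrMr ?mulr_gt0//.
apply: (@le_trans _ _ (expR (- t) * (s - t))).
  rewrite es -subr_ge0.
  rewrite (_ : _ - _ = expR (- t) * (expR (t - s) - (1 + (t - s)))); last ring.
  by rewrite mulr_ge0 ?subr_ge0 ?expR_ge0.
rewrite mulrC ler_wpM2l ?subr_ge0//.
have := mulr_gt0 dt ds; lra.
Qed.

(** The logistic equation; this form of [e^-s / (1 + e^-s)^2] is what makes [dsqloss] polynomial in
    the sigmoid. *)
Lemma is_derive_sigmoid s :
  is_derive s 1 sigmoid (sigmoid s * (1 - sigmoid s)).
Proof.
have d1 : is_derive s 1 (fun u : R => 1 + expR (- u)) (- expR (- s)).
  have -> : (fun u : R => 1 + expR (- u)) = cst 1 + (expR \o -%R) by [].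
  by apply: is_derive_eq; rewrite add0r mulrN1.
have := @is_deriveV _ (fun u => 1 + expR (- u)) _ _ _
  (lt0r_neq0 (den_gt0 s)) d1.
move=> /is_derive_eq; apply.
by rewrite /sigmoid /GRing.scale /=; field; rewrite gt_eqF.
Qed.

Definition sqloss y s : R := (y - sigmoid s) ^+ 2.

Definition dsqloss y s : R :=
  2 * (sigmoid s - y) * (sigmoid s * (1 - sigmoid s)).

Lemma is_derive_sqloss y s : is_derive s 1 (sqloss y) (dsqloss y s).
Proof.
have -> : sqloss y = (cst y - sigmoid) ^+ 2 by apply/funext.
have ds := is_derive_sigmoid s.
apply: is_derive_eq.
by rewrite /dsqloss /GRing.scale /= !fctE; ring.
Qed.

Lemma continuous_dsqloss y : continuous (dsqloss y).
Proof.
have cs : continuous sigmoid.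
  move=> s; apply/differentiable_continuous/derivable1_diffP.
  by have := is_derive_sigmoid s.
move=> s; apply: cvgM; [apply: cvgM; first exact: cvg_cst|apply: cvgM].
- by apply: cvgB; [exact: cs|exact: cvg_cst].
- exact: cs.
- by apply: cvgB; [exact: cvg_cst|exact: cs].
Qed.

(** With [p] the sigmoid value, [|p - y| <= 1 + B] and [0 <= p (1 - p) <= 1]. *)
Lemma dsqloss_bounded (B : R) y s : `|y| <= B -> `|dsqloss y s| <= 2 * (1 + B).
Proof.
move=> yB; have := sigmoid_ge0 s; have := sigmoid_le1 s.
rewrite /dsqloss; set p := sigmoid s => p1 p0.
rewrite !normrM (ger0_norm p0) (@ger0_norm _ (1 - p)) ?subr_ge0// ger0_norm//.
have H : `|p - y| <= 1 + B.
  by rewrite (le_trans (ler_normB _ _))// lerD// ger0_norm.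
rewrite -[leRHS]mulr1 ler_pM ?mulr_ge0 ?normr_ge0 ?subr_ge0//.
  by rewrite ler_pM2l.
by rewrite mulr_ile1 ?subr_ge0// gerBl.
Qed.

(* [dsqloss] is a cubic polynomial in [sigmoid s], which lies in [0, 1]. *)
Lemma dsqloss_lipschitz (B : R) y s t : `|y| <= B ->
  `|dsqloss y s - dsqloss y t| <= 2 * (5 + 3 * B) * `|s - t|.
Proof.
move=> yB; have B0 : 0 <= B := le_trans (normr_ge0 _) yB.
have := sigmoid_lipschitz s t.
have := sigmoid_ge0 s; have := sigmoid_le1 s.
have := sigmoid_ge0 t; have := sigmoid_le1 t.
rewrite /dsqloss; set p := sigmoid s; set q := sigmoid t => q1 q0 p1 p0 pq.
(* The factor [p - q] is pulled out of the difference of cubics. The cofactor is bounded crudely by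
   the triangle inequality on [0, 1]: 5 = 2 + 3 for the part free of [y], 3 = 2 + 1 for the
   coefficient of [y]. *)
rewrite (_ : _ - _ = 2 * (((p + q) - (p ^+ 2 + p * q + q ^+ 2)
  + y * (p + q - 1))) * (p - q)); last ring.
rewrite !normrM ger0_norm//.
apply: ler_pM; rewrite ?mulr_ge0 ?normr_ge0//.
rewrite ler_pM2l//; apply: (le_trans (ler_normD _ _)); apply: lerD.
  rewrite ler_norml; apply/andP; split; nra.
rewrite normrM mulrC ler_pM ?normr_ge0//.
by rewrite ler_norml; apply/andP; split; lra.
Qed.

(** Both arguments vary because a change of data point moves the label and the scalar product
    together. The difference of squares factors; the sum is at most [2 (1 + B)], and the 1-Lipschitz
    sigmoid controls the difference. *)
Lemma sqloss_lipschitz (B : R) y1 y2 s1 s2 : `|y1| <= B -> `|y2| <= B ->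
  `|sqloss y1 s1 - sqloss y2 s2| <= 2 * (1 + B) * (`|y1 - y2| + `|s1 - s2|).
Proof.
move=> y1B y2B; have pq := sigmoid_lipschitz s1 s2.
have := sigmoid_ge0 s1; have := sigmoid_le1 s1.
have := sigmoid_ge0 s2; have := sigmoid_le1 s2.
move: pq; rewrite /sqloss.
set p := sigmoid s1; set q := sigmoid s2 => pq q1 q0 p1 p0.
rewrite subr_sqr mulrC normrM; apply: ler_pM; rewrite ?normr_ge0//.
  move: y1B y2B; rewrite !ler_norml => /andP[? ?] /andP[? ?].
  by apply/andP; split; lra.
rewrite (_ : _ - _ = (y1 - y2) - (p - q)); last ring.
by rewrite (le_trans (ler_normB _ _))// lerD2l.
Qed.

End sigmoid.

(** * The loss as a ridge function of the parameter *)

Section loss_gradient.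
Variables (R : realType) (n : nat).
Implicit Types t x : 'rV[R]_(n + 1).

(** The constant last entry absorbs the bias [b0], making the affine pre-activation a scalar
    product. *)
Definition augment x : 'rV[R]_(n + 1) := row_mx (lsubmx x) (const_mx 1).

Lemma lossE t x : loss t x = sqloss (rsubmx x 0 0) (dot t (augment x)).
Proof.
rewrite /loss /sqloss /neuron /sigmoid real_normK ?num_real// div1r.
by rewrite -[t in RHS]hsubmxK dot_row_mx dot_rV1 [const_mx _ _ _]mxE mulr1.
Qed.

Lemma gradient_loss t x : gradient (fun t' => loss t' x) t =
  dsqloss (rsubmx x 0 0) (dot t (augment x)) *: augment x.
Proof.
have -> : (fun t' => loss t' x) =
    fun t' => sqloss (rsubmx x 0 0) (dot t' (augment x)).
  by apply/funext => t'; exact: lossE.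
exact/gradient_ridge/is_derive_sqloss.
Qed.

Lemma continuously_differentiable_loss x :
  continuously_differentiable (fun t => loss t x).
Proof.
split=> [t|].
  have -> : (fun t' => loss t' x) =
      fun t' => sqloss (rsubmx x 0 0) (dot t' (augment x)).
    by apply/funext => t'; exact: lossE.
  apply: differentiable_ridge.
  by have := is_derive_sqloss (rsubmx x 0 0) (dot t (augment x)).
have -> : gradient (fun t => loss t x) =
    fun t => dsqloss (rsubmx x 0 0) (dot t (augment x)) *: augment x.
  by apply/funext => t; exact: gradient_loss.
move=> t.
have ct := differentiable_continuous (differentiable_dot (augment x) t).
have dct : {for t, continuous
    (fun u => dsqloss (rsubmx x 0 0) (dot u (augment x)))}.
  exact: (continuous_comp ct (@continuous_dsqloss _ (rsubmx x 0 0) _)).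
exact: (@cvgZr_tmp _ _ _ _ _ _ _ (augment x) dct).
Qed.

(** Here [|(z, 1)|^2 = |z|^2 + 1 <= B^2 + 1 <= (1 + B)^2]. *)
Lemma enorm_augment (B : R) x : enorm x <= B -> enorm (augment x) <= 1 + B.
Proof.
move=> xB; have B0 := le_trans (enorm_ge0 x) xB.
have zB := le_trans (enorm_lsubmx x) xB.
rewrite -(@ler_pXn2r _ 2) ?nnegrE ?addr_ge0 ?enorm_ge0//.
rewrite sqr_enorm dot_row_mx dot_rV1 !mxE -sqr_enorm.
have : enorm (lsubmx x) ^+ 2 <= B ^+ 2 by rewrite ler_pXn2r ?nnegrE ?enorm_ge0.
nra.
Qed.

(** The constant entries cancel, so only the [z] parts and the weights [w] remain for
    Cauchy-Schwarz. *)
Lemma normr_dot_augmentB t x1 x2 :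
  `|dot t (augment x1) - dot t (augment x2)| <= enorm t * enorm (x1 - x2).
Proof.
rewrite -dotBr /augment opp_row_mx add_row_mx subrr -linearB/=.
rewrite -{1}[t]hsubmxK dot_row_mx dot_rV1 [X in _ + _ * X]mxE mulr0 addr0.
by rewrite (le_trans (normr_dot_le _ _))// ler_pM ?enorm_ge0 ?enorm_lsubmx.
Qed.

End loss_gradient.

Theorem proposition3p1 (R : realType) (n : nat) (Xi : set 'rV[R]_(n + 1))
    (Xi_compact : compact Xi) :
  [/\ forall x : 'rV[R]_(n + 1), Xi x ->
        continuously_differentiable (fun t : 'rV[R]_(n + 1) => loss t x),
      exists2 L : R, 0 < L &
        forall t1 t2 x : 'rV[R]_(n + 1), Xi x ->
          enorm (gradient (fun t => loss t x) t1
                 - gradient (fun t => loss t x) t2) <= L * enorm (t1 - t2)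
    & exists2 K : R, 1 < K &
        forall t x : 'rV[R]_(n + 1), Xi x ->
          enorm (gradient (fun t' => loss t' x) t) <= K]
  /\
  (exists2 J : R, 0 < J &
     forall t x1 x2 : 'rV[R]_(n + 1), Xi x1 -> Xi x2 ->
       `|loss t x1 - loss t x2| <= J * (1 + enorm t) * enorm (x1 - x2)).
Proof.
have [B B0 XiB] := compact_enorm_bounded Xi_compact.
have yB x : Xi x -> `|rsubmx x 0 0| <= B.
  by move=> /XiB; apply: le_trans (normr_rsubmx _).
have aB x : Xi x -> enorm (augment x) <= 1 + B by move=> /XiB/enorm_augment.
have B1 : 0 < 1 + B by rewrite addrC ltr_wpDl.
split; [split|].
- by move=> x _; exact: continuously_differentiable_loss.
(* The Lipschitz constant of [dsqloss] times two bounds on [|a|]: one for the vector outside, one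
   from Cauchy-Schwarz on [<t1 - t2, a>]. *)
- exists (2 * (5 + 3 * B) * (1 + B) * (1 + B)); first by rewrite !mulr_gt0//; lra.
  move=> t1 t2 x Xx; rewrite !gradient_loss -scalerBl enormZ.
  rewrite mulrAC ler_pM ?enorm_ge0 ?aB//.
  rewrite (le_trans (dsqloss_lipschitz _ _ (yB _ Xx)))//.
  rewrite -[leRHS]mulrA ler_wpM2l//; first lra.
  rewrite -dotBl (le_trans (normr_dot_le _ _))// mulrC.
  by rewrite ler_wpM2r ?enorm_ge0 ?aB.
- exists (2 * (1 + B) * (1 + B)); first nra.
  move=> t x Xx; rewrite gradient_loss enormZ ler_pM ?enorm_ge0 ?aB//.
  exact/dsqloss_bounded/yB.
(* In the factor [1 + |t|], the 1 pays for the change of label and [|t|] for the change of scalar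
   product. *)
- exists (2 * (1 + B)); first by rewrite mulr_gt0.
  move=> t x1 x2 Xx1 Xx2; rewrite !lossE.
  apply: (le_trans (sqloss_lipschitz _ _ (yB _ Xx1) (yB _ Xx2))).
  rewrite -[leRHS]mulrA; apply: ler_wpM2l; first by rewrite mulr_ge0 ?ltW.
  rewrite [leRHS]mulrDl mul1r lerD//.
    by have := normr_rsubmx (x1 - x2); rewrite linearB/= !mxE.
  exact: normr_dot_augmentB.
Qed.
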